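(* Let $q=2^e$ with $e>1$, and let $q_0$ be such that $q=q_0^r$ for a prime $r$. Then the subfield subgroup $\mathrm{Sp}_4(q_0)\le\mathrm{Sp}_4(q)$ is not a strong Gelfand subgroup, i.e. $(\mathrm{Sp}_4(q),\mathrm{Sp}_4(q_0))$ is not a strong Gelfand pair.
   Context: All characters are complex. A pair $(G,H)$ with $H\le G$ finite is a strong Gelfand pair (and $H$ a strong Gelfand subgroup) if for every irreducible character $\psi$ of $H$, the induced character $\psi\uparrow G$ satisfies $\langle \psi\uparrow G,\chi\rangle\le 1$ for every irreducible character $\chi$ of $G$. $\mathrm{Sp}_4(q)$ is the symplectic group of a nondegenerate alternating form on $\mathbb{F}_q^4$, and $\mathrm{Sp}_4(q_0)$ is the subgroup of its elements with all matrix entries (in a symplectic basis) in the subfield $\mathbb{F}_{q_0}$. *)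

(* Defs.v *)
From HB Require Import structures.
From mathcomp Require Import all_boot all_order all_algebra all_fingroup all_solvable all_field all_character.
Set Implicit Arguments. Unset Strict Implicit. Unset Printing Implicit Defensive.
Import Order.TTheory GRing.Theory Num.Theory.
Local Open Scope ring_scope.

Section Symplectic.
Variable F : finFieldType.

(* Gram matrix of the standard nondegenerate alternating form on F^4 in the
   symplectic basis (e1, e2, f1, f2):  J = [[0, I_2], [-I_2, 0]]. *)
Definition sympJ : 'M[F]_4 :=
  \matrix_(i < 4, j < 4)
    (if (i < 2)%N && (j == i + 2 :> nat) then 1
     else if (2 <= i)%N && (i == j + 2 :> nat) then -1 else 0).

Definition Sp4_set : {set {'GL_4[F]}} :=
  [set g : {'GL_4[F]} | (GLval g)^T *m sympJ *m GLval g == sympJ].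

Lemma Sp4_group_set : group_set Sp4_set.
Proof.
apply/group_setP; split.
  by rewrite inE GL_1E mulmx1 trmx1 mul1mx.
move=> x y; rewrite !inE => /eqP Hx /eqP Hy.
rewrite GL_MxE trmx_mul; apply/eqP.
have -> : (GLval y)^T *m (GLval x)^T *m sympJ *m (GLval x *m GLval y)
  = (GLval y)^T *m ((GLval x)^T *m sympJ *m GLval x) *m GLval y.
  by rewrite !mulmxA.
by rewrite Hx.
Qed.

Canonical Sp4 : {group {'GL_4[F]}} := Group Sp4_group_set.

Definition Sp4_over (K : {set F}) : {set {'GL_4[F]}} :=
  [set g in Sp4 | [forall i, forall j, (GLval g) i j \in K]].

End Symplectic.

Definition strong_Gelfand_pair (gT : finGroupType) (G H : {group gT}) : Prop :=
  H \subset G /\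
  forall (i : Iirr H) (j : Iirr G), '['Ind[G] 'chi[H]_i, 'chi[G]_j] <= 1.

(* Main.v *)
(* If (G, H) is a strong Gelfand pair, then the H-class sums of G commute in the
   group algebra, so for all x, y in G the product x y also has the form
   y^h x^k with h, k in H. For K the proper subfield and d outside K, take
   x = 1 + d^-1 E_{02} and y = 1 + (1 + d)^-1 E_{20}, two elements of one root
   SL_2. Clearing denominators in x y = y^h x^k and comparing the coefficients of
   1 and d over K gives, with A = E_{02}, B = E_{20}, A' = A^k, B' = B^h,
   A + B = A' + B' and A + AB = A' + B'A' = (1 + A + B)A', where A'^2 = 0. In
   characteristic 2 the row vector e_0 + e_2 kills 1 + A + B but not A + AB. *)
Require Import Defs.
From HB Require Import structures.
From mathcomp Require Import all_boot all_order all_algebra all_fingroup all_solvable all_field all_character.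
From mathcomp Require Import ring.
Import Order.TTheory GRing.Theory Num.Theory.
Local Open Scope ring_scope.

(** [socle_mult] is a truncating quotient of ranks; the division is exact because the component is a
    direct sum of modules isomorphic to its base. *)
Lemma socle_rank_mult (F : fieldType) (gT : finGroupType) (G : {group gT})
    (n : nat) (rG : mx_representation F G n) (sG : socleType rG) (W : sG) :
  \rank W = (socle_mult W * \rank (socle_base W))%N.
Proof.
have simU := socle_simple W; have [I V S simV defV dxV] := component_mx_semisimple simU.
have rankU_gt0 : (0 < \rank (socle_base W))%N by rewrite lt0n mxrank_eq0; case: simU.
have rankW : \rank W = (#|I| * \rank (socle_base W))%N.
  have -> : \rank W = \rank S by rewrite defV.
  rewrite (mxdirectP dxV) /= -sum_nat_const; apply: eq_bigr => i _; apply/esym.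
  have sVW : (V i <= component_mx rG (socle_base W))%MS by rewrite -defV (sumsmx_sup i).
  exact: mxrank_iso (component_mx_iso simU (simV i) sVW).
by rewrite /socle_mult rankW mulnK.
Qed.

(** By Maschke the socle is the whole space, so traces add up over the isotypic components. *)
Lemma cfRepr_socle (gT : finGroupType) (G : {group gT}) (n : nat)
    (rG : mx_representation algC G n) (sG : socleType rG) :
  cfRepr rG = \sum_(W : sG) cfRepr (socle_repr W) *+ socle_mult W.
Proof.
have defS : (Socle sG :=: 1%:M)%MS.
  rewrite reducible_Socle1 //; exact: mx_Maschke_pchar (algC'G_pchar G).
apply/cfun_inP => x Gx; rewrite cfunE Gx mulr1n -(mxtrace_submod1 (Socle_module sG) defS) //.
rewrite mxtrace_Socle // sum_cfunE; apply: eq_bigr => W _.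
by rewrite muln_cfunE cfunE Gx mulr1n.
Qed.

(** Schur's lemma inside the ambient space: over an algebraically closed field, an endomorphism of a
    simple module is a scalar. *)
Lemma centgmx_simple_scalar (gT : finGroupType) (G : {group gT}) (n : nat)
    (rG : mx_representation algC G n) (U M : 'M_n) :
  mxsimple rG U -> centgmx rG M -> (U *m M <= U)%MS ->
  exists a : algC, U *m M = a *: U.
Proof.
move=> simU cM sUM; have modU := mxsimple_module simU.
(* [N] is the matrix of [M] restricted to [U], in the row basis of [U]. *)
pose N := in_submod U (val_submod (1%:M : 'M_(\rank U)) *m M).
have sVM (m : nat) (V : 'M_(m, n)) : (V <= U)%MS -> (V *m M <= U)%MS.
  by move=> sVU; apply: submx_trans (submxMr M sVU) sUM.
have valN (m : nat) (V : 'M_(m, \rank U)) : val_submod (V *m N) = val_submod V *m M.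
  rewrite val_submodE -mulmxA -val_submodE /N in_submodK ?sVM ?val_submodP //.
  by rewrite mulmxA -val_submodE.
have cN : centgmx (submod_repr modU) N.
  apply/centgmxP => x Gx; apply: (@val_submod_inj _ _ U).
  rewrite valN -[N]mul1mx val_submodJ // valN -[submod_repr modU x]mul1mx.
  by rewrite val_submodJ // -!mulmxA (centgmxP cM).
have absU : mx_absolutely_irreducible (submod_repr modU).
  by apply: groupC; apply/submod_mx_irr.
have /is_scalar_mxP[a defN] := mx_abs_irr_cent_scalar absU cN.
exists a; have := valN _ (in_submod U U).
by rewrite in_submodK // => <-; rewrite defN mul_mx_scalar linearZ /= in_submodK.
Qed.

(** Multiplicity one makes each isotypic component simple, so [M] and [N] act on it by scalars;
    their commutator then vanishes on the components, which span. *)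
Lemma mult_free_centgmx_comm (gT : finGroupType) (G : {group gT}) (n : nat)
    (rG : mx_representation algC G n) (M N : 'M_n) :
  (forall i : Iirr G, '[cfRepr rG, 'chi_i] <= 1) ->
  centgmx rG M -> centgmx rG N -> M *m N = N *m M.
Proof.
move=> mf cM cN; pose sG : socleType rG := DecSocleType rG.
have mult1 (W : sG) : (socle_mult W <= 1)%N.
  have /irrP[i Wi] : cfRepr (socle_repr W) \in irr G.
    by apply/irr_reprP; exists (Representation (socle_repr W)) => //; apply: socle_irr.
  (* The other components contribute nonnegative terms, so this inner product bounds the
     multiplicity of [W]. *)
  have := mf i; rewrite -Wi (cfRepr_socle _ _ _ _ sG) cfdot_suml (bigD1 W) //=.
  rewrite cfdotMnl Wi cfnorm_irr -Wi -(ler_nat algC); apply: le_trans.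
  rewrite lerDl sumr_ge0 // => V _; rewrite cfdotMnl mulrn_wge0 //.
  by apply/natr_ge0/Cnat_cfdot_char; apply: cfRepr_char.
have sWU (W : sG) : (W <= socle_base W)%MS.
  rewrite -(geq_leqif (mxrank_leqif_sup (component_mx_id (socle_simple W)))).
  by rewrite -/(socle_val W) socle_rank_mult -[leqRHS]mul1n leq_mul2r mult1 orbT.
have scal (W : sG) (A : 'M_n) : centgmx rG A -> exists a, socle_base W *m A = a *: socle_base W.
  move=> cA; apply: (centgmx_simple_scalar _ _ _ _ _ _ (socle_simple W) cA).
  apply: submx_trans (submxMr A (component_mx_id (socle_simple W))) _.
  apply: submx_trans (sWU W).
  by apply: hom_component_mx; [apply: socle_simple | apply: centgmx_hom].
have base0 (W : sG) : socle_base W *m (M *m N - N *m M) = 0.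
  have [[a aM] [b bN]] := (scal W M cM, scal W N cN).
  by rewrite mulmxBr !mulmxA aM bN -!scalemxAl aM bN !scalerA mulrC subrr.
apply/eqP; rewrite -subr_eq0 -[_ - _]mul1mx -submx0.
have <- : Socle sG = 1%:M by apply/reducible_Socle1/mx_Maschke_pchar/algC'G_pchar.
rewrite sumsmxMr; apply/sumsmx_subP => W _; rewrite -(base0 W); exact: submxMr.
Qed.

(* An H-class sum acts on each irreducible representation of G by an H-endomorphism,
   so multiplicity-freeness makes class sums commute; the regular character
   then reads off coefficients. *)
Lemma strong_Gelfand_swap (gT : finGroupType) (G H : {group gT}) (x y : gT) :
  strong_Gelfand_pair G H -> x \in G -> y \in G ->
  exists h k, [/\ h \in H, k \in H & (x * y = y ^ h * x ^ k)%g].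
Proof.
(* Multiplying by [z] sends [x * y] to the identity, where the regular character is supported. *)
move=> [sHG mf] Gx Gy; pose z := (x * y)^-1%g.
have Gz : z \in G by rewrite groupV groupM.
have GJ u h : u \in G -> h \in H -> (u ^ h)%g \in G.
  by move=> Gu Hh; rewrite groupJ // (subsetP sHG).
have sumC (i : Iirr G) :
  \sum_(h in H) \sum_(k in H) 'chi_i (x ^ h * y ^ k * z)%g =
  \sum_(h in H) \sum_(k in H) 'chi_i (y ^ h * x ^ k * z)%g.
  have /irr_reprP[rG _ chiE] := mem_irr i.
  pose S u := \sum_(h in H) rG (u ^ h)%g.
  have cS u : u \in G -> centgmx (subg_repr rG sHG) (S u).
    move=> Gu; apply/centgmxP => h Hh /=; rewrite /S mulmx_suml mulmx_sumr.
    have Gh := subsetP sHG h Hh.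
    (* Conjugation by [h] permutes the terms of [S u]. *)
    rewrite (reindex_inj (mulIg h^-1%g)) /=; apply: eq_big => [k|k Hk].
      by rewrite groupMr ?groupV.
    have Hk' : k \in H by move: Hk; rewrite groupMr ?groupV.
    rewrite -!repr_mxM ?GJ ?(groupM, groupV) // conjgM -conjgCV //.
  have SC : S x *m S y = S y *m S x.
    apply: (mult_free_centgmx_comm _ _ _ (subg_repr rG sHG)); rewrite ?cS // => j.
    (* Frobenius reciprocity: the restriction of [rG] to [H] is multiplicity-free. *)
    by rewrite cfRepr_sub -chiE cfdot_Res_l cfdotC_char ?cfInd_char ?irr_char ?mf.
  have tr u v : u \in G -> v \in G ->
    \sum_(h in H) \sum_(k in H) 'chi_i (u ^ h * v ^ k * z)%g = \tr (S u *m S v *m rG z).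
    move=> Gu Gv; rewrite /S 2!mulmx_suml raddf_sum; apply: eq_bigr => h Hh.
    rewrite -mulmxA mulmx_suml mulmx_sumr raddf_sum; apply: eq_bigr => k Hk.
    have [Guh Gvk] := (GJ u h Gu Hh, GJ v k Gv Hk).
    rewrite chiE cfunE (groupM (groupM Guh Gvk) Gz) mulr1n.
    by rewrite (repr_mxM rG (groupM Guh Gvk) Gz) (repr_mxM rG Guh Gvk) -mulmxA.
  by rewrite !tr // SC.
have regE u v : \sum_(h in H) \sum_(k in H) cfReg G (u ^ h * v ^ k * z)%g =
    \sum_i 'chi[G]_i 1%g * (\sum_(h in H) \sum_(k in H) 'chi_i (u ^ h * v ^ k * z)%g).
  under [RHS]eq_bigr => i _ do rewrite mulr_sumr.
  rewrite [RHS]exchange_big; apply: eq_bigr => h _ /=.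
  under [RHS]eq_bigr => i _ do rewrite mulr_sumr.
  rewrite [RHS]exchange_big; apply: eq_bigr => k _ /=.
  by rewrite cfReg_sum sum_cfunE; apply: eq_bigr => i _; rewrite cfunE.
have regC : \sum_(h in H) \sum_(k in H) cfReg G (x ^ h * y ^ k * z)%g =
    \sum_(h in H) \sum_(k in H) cfReg G (y ^ h * x ^ k * z)%g.
  by rewrite !regE; apply: eq_bigr => i _; rewrite sumC.
have reg_ge0 u : 0 <= cfReg G u by rewrite cfRegE mulrn_wge0 ?ler0n.
have [/existsP[h /existsP[k /and3P[Hh Hk /eqP xyE]]] | noswap] :=
  boolP [exists h, exists k, [&& h \in H, k \in H & (x * y)%g == (y ^ h * x ^ k)%g]].
  by exists h, k.
(* The term [h = k = 1] is the order of [G] and no term is negative; without a swap, every term of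
   the sum in the other order would vanish. *)
have : 0 < \sum_(h in H) \sum_(k in H) cfReg G (x ^ h * y ^ k * z)%g.
  rewrite (bigD1 1%g) //= (bigD1 1%g) //= !conjg1 mulgV cfRegE eqxx mulr1n -addrA.
  rewrite ltr_wpDr ?ltr0n ?cardG_gt0 //.
  by rewrite addr_ge0 // !sumr_ge0 // => h _; rewrite sumr_ge0.
rewrite regC big1 ?ltxx // => h Hh; rewrite big1 // => k Hk.
rewrite cfRegE -eq_mulgV1; case: eqP => // E; case/existsP: noswap.
by exists h; apply/existsP; exists k; rewrite Hh Hk -E eqxx.
Qed.

Lemma divring_closed_mulmx (F : finFieldType) (K : {set F}) (m n p : nat)
    (M : 'M[F]_(m, n)) (N : 'M_(n, p)) :
  GRing.divring_closed K -> (forall i j, M i j \in K) -> (forall i j, N i j \in K) ->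
  forall i j, (M *m N) i j \in K.
Proof.
move=> /GRing.divring_closedBM cK KM KN i j; rewrite mxE.
have [K0 KD] := GRing.zmod_closedD (GRing.subring_closedB cK).
by elim/big_ind: _ => // k _; case: cK => _ _; apply.
Qed.

(** [1] and [d] are linearly independent over [K]: differing entries of [Q] and [Q'] would exhibit
    [d] as a quotient of elements of [K]. *)
Lemma divring_closed_split (F : finFieldType) (K : {set F}) (m n : nat) (d : F)
    (P Q P' Q' : 'M[F]_(m, n)) :
  GRing.divring_closed K -> d \notin K ->
  (forall i j, P i j \in K) -> (forall i j, Q i j \in K) ->
  (forall i j, P' i j \in K) -> (forall i j, Q' i j \in K) ->
  P + d *: Q = P' + d *: Q' -> P = P' /\ Q = Q'.
Proof.
move=> [K1 KB KV] dK KP KQ KP' KQ' /matrixP eqPQ.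
have eqQ : Q = Q'.
  apply/matrixP => i j; apply/eqP; apply: contraNT dK => neqQ.
  have := eqPQ i j; rewrite !mxE => eqij.
  have -> : d = (P' i j - P i j) / (Q i j - Q' i j); last by rewrite KV ?KB.
  apply: (canRL (mulfK _)); rewrite ?subr_eq0 // mulrBr.
  by apply/eqP; rewrite subr_eq addrAC eq_sym subr_eq -eqij addrC.
split=> //; apply/matrixP => i j; have := eqPQ i j.
by rewrite eqQ !mxE => /addIr.
Qed.

Lemma sympJE (F : finFieldType) :
  sympJ F = delta_mx 0 2 + delta_mx 1 3 - delta_mx 2 0 - delta_mx 3 1.
Proof.
apply/matrixP => i j; rewrite !mxE.
by case: i => [[|[|[|[|//]]]] ?]; case: j => [[|[|[|[|//]]]] ?];
   rewrite /= ?(subr0, addr0, add0r, sub0r).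
Qed.

(** In characteristic 2, [1 + c A] is its own inverse, hence invertible. Moving its transpose across
    the form [J] leaves [J (1 + c A)^2 = J]. *)
Lemma Sp4_transvection (F : finFieldType) (A : 'M[F]_4) (c : F) :
  2 \in [pchar F] -> A *m A = 0 -> A^T *m sympJ F = sympJ F *m A ->
  exists2 g, g \in Sp4 F & GLval g = 1%:M + c *: A.
Proof.
move=> ch2 A2 AJ.
have sq1 : (1%:M + c *: A) *m (1%:M + c *: A) = 1%:M.
  rewrite mulmxDl !mulmxDr !mulmx1 !mul1mx -scalemxAl -scalemxAr A2 !scaler0 addr0.
  by rewrite -addrA -scalerDl addrr_pchar2 // scale0r addr0.
have [uA _] := mulmx1_unit sq1.
exists (FinRing.unit _ uA : {'GL_4[F]}) => //.
have trE : (1%:M + c *: A)^T = 1%:M + c *: A^T.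
  by apply/matrixP => i j; rewrite !mxE eq_sym.
rewrite inE /= trE mulmxDl mul1mx -scalemxAl AJ.
rewrite mulmxDr mulmx1 -scalemxAr mulmxDl -scalemxAl -mulmxA A2 mulmx0 scaler0 addr0.
by rewrite -addrA -scalerDl addrr_pchar2 // scale0r addr0.
Qed.

Lemma GLval_conj (F : finFieldType) (A : 'M[F]_4) (c : F) (x k : {'GL_4[F]}) :
  GLval x = 1%:M + c *: A ->
  GLval (x ^ k)%g = 1%:M + c *: (GLval k^-1%g *m A *m GLval k).
Proof.
move=> xE; have kV : GLval k^-1%g *m GLval k = 1%:M by rewrite -GL_MxE mulVg GL_1E.
rewrite !GL_MxE xE mulmxA mulmxDr mulmxDl mulmx1 kV.
by rewrite -scalemxAr -scalemxAl.
Qed.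

Theorem theorem5p4 (F : finFieldType) (e : nat) (K : {set F}) (r : nat)
    (H : {group {'GL_4[F]}}) :
  #|F| = (2 ^ e)%N -> (1 < e)%N ->
  GRing.divring_closed K -> prime r -> #|F| = (#|K| ^ r)%N ->
  H :=: Sp4_over K ->
  ~ strong_Gelfand_pair (Sp4 F) H.
Proof.
move=> cardF e_gt1 cK r_pr cardFK defH sgp.
have ch2 : 2 \in [pchar F].
  have : #|F|%:R = 0 :> F by rewrite -FinRing.zmodXgE -cardsT expg_cardG // inE.
  by rewrite cardF natrX => /eqP; rewrite expf_eq0 !inE => /andP[_].
(* [K] is proper, since its order is a proper root of that of [F]. *)
have [d dK] : exists d, d \notin K.
  apply/existsP; apply: contraTT (finNzRing_gt1 F) => /existsPn allK.
  have cardK : #|K| = #|F| by apply: eq_card => a; apply/negbNE/allK.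
  rewrite -leqNgt leqNgt; apply/negP => F_gt1; have := ltn_exp2l 1 r F_gt1.
  by rewrite expn1 prime_gt1 // -[X in (_ < X ^ r)%N]cardK -cardFK ltnn.
have [K1 KB KV] := cK; have K0 : 0 \in K by rewrite -(subrr 1) KB.
have d0 : d != 0 by apply: contraNneq dK => ->.
have d1 : 1 + d != 0.
  apply: contraNneq dK => /(canRL (addKr _)) ->; rewrite addr0 -sub0r.
  exact: KB.
pose A : 'M[F]_4 := delta_mx 0 2; pose B : 'M[F]_4 := delta_mx 2 0.
have A2 : A *m A = 0 by rewrite mul_delta_mx_0.
have B2 : B *m B = 0 by rewrite mul_delta_mx_0.
have oppM m n (M : 'M[F]_(m, n)) : - M = M by apply/matrixP => i j; rewrite mxE oppr_pchar2.
(* With the scalars [d^-1] and [(1 + d)^-1], multiplying [x y] by [d (1 + d)] gives [A], [B], [A B]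
   the coefficients [1 + d], [d], [1]. These are linear in [d], so independence of [1] and [d]
   suffices. *)
have [x Gx xE] : exists2 x, x \in Sp4 F & GLval x = 1%:M + d^-1 *: A.
  apply: Sp4_transvection => //; rewrite trmx_delta sympJE.
  rewrite !(mulmxDl, mulmxDr, mulNmx, mulmxN) !mul_delta_mx_cond /=.
  by rewrite !(mulr0n, oppM, addr0, add0r).
have [y Gy yE] : exists2 y, y \in Sp4 F & GLval y = 1%:M + (1 + d)^-1 *: B.
  apply: Sp4_transvection => //; rewrite trmx_delta sympJE.
  rewrite !(mulmxDl, mulmxDr, mulNmx, mulmxN) !mul_delta_mx_cond /=.
  by rewrite !(mulr0n, oppM, addr0, add0r).
have [h [k [Hh Hk /(congr1 (@GLval _ _)) xy]]] := strong_Gelfand_swap _ _ _ x y sgp Gx Gy.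
have KH g : g \in H -> forall i j, GLval g i j \in K.
  by rewrite defH inE => /andP[_ /forallP Kg] i j; have /forallP := Kg i.
have Kdelta (a b : 'I_4) i j : (delta_mx a b : 'M[F]_4) i j \in K.
  by rewrite mxE; case: (_ && _).
pose A' := GLval k^-1%g *m A *m GLval k; pose B' := GLval h^-1%g *m B *m GLval h.
have KM (M N : 'M[F]_4) KM KN := divring_closed_mulmx _ _ _ _ _ M N cK KM KN.
have KAm i j : A i j \in K by exact: Kdelta.
have KBm i j : B i j \in K by exact: Kdelta.
have KA' : forall i j, A' i j \in K.
  by apply: KM (KM _ _ (KH _ _) KAm) (KH _ Hk); rewrite groupV.
have KB' : forall i j, B' i j \in K.
  by apply: KM (KM _ _ (KH _ _) KBm) (KH _ Hh); rewrite groupV.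
have A'2 : A' *m A' = 0.
  rewrite /A' !mulmxA -(mulmxA _ (GLval k)) -GL_MxE mulgV GL_1E mulmx1.
  by rewrite -(mulmxA _ A A) A2 mulmx0 mul0mx.
have KD (M N : 'M[F]_4) : (forall i j, M i j \in K) -> (forall i j, N i j \in K) ->
    forall i j, (M + N) i j \in K.
  by move=> KMM KN i j; rewrite mxE -[N i j]opprK -[- N i j]sub0r !KB.
have [eqAB eqS] : A + A *m B = A' + B' *m A' /\ A + B = A' + B'.
  apply: (divring_closed_split _ _ _ _ d _ _ _ _ cK dK); do ?apply: KD => //.
  - exact: KM.
  - exact: KM.
  move: xy; rewrite 2!GL_MxE xE yE (GLval_conj _ _ _ _ _ xE) (GLval_conj _ _ _ _ _ yE).
  rewrite -/A' -/B' !mulmxDl !mulmxDr !mul1mx !mulmx1 -!scalemxAl -!scalemxAr !scalerA.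
  (* Applied to [A], [B], [A B] and to [A'], [B'], [B' A']. *)
  have clear_denom (M N P : 'M[F]_4) : (d * (1 + d)) *: (1%:M + d^-1 *: M + (1 + d)^-1 *: N
      + (d^-1 * (1 + d)^-1) *: P) = (d * (1 + d)) *: 1%:M + (M + P + d *: (M + N)).
    by apply/matrixP => i j; rewrite !mxE; field; rewrite d0 d1.
  rewrite [(1 + d)^-1 * _]mulrC !addrA => xy1.
  apply: (addrI ((d * (1 + d)) *: 1%:M)); rewrite -!clear_denom -xy1.
  by congr (_ *: (_ + _)); apply: addrAC.
(* [A] sends [e_0] to [e_2] and [B] sends [e_2] to [e_0], so [A + B] fixes [z] and
   [z (1 + A + B) = 2 z = 0]. *)
pose z : 'rV[F]_4 := delta_mx 0 0 + delta_mx 0 2.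
have zS : z *m (1%:M + (A + B)) = 0.
  rewrite !(mulmxDl, mulmxDr) !mulmx1 !mul_delta_mx_cond /= !mulr0n !mulr1n.
  by rewrite addr0 add0r [X in _ + X]addrC -[X in _ + X]oppM subrr.
have : z *m (A + A *m B) = 0.
  rewrite eqAB.
  have -> : A' + B' *m A' = (1%:M + (A + B)) *m A'.
    by rewrite eqS !mulmxDl mul1mx A'2 add0r.
  by rewrite mulmxA zS mul0mx.
(* Since [A B = E_{00}], the product is [z] itself, whose entry at 0 is 1. *)
rewrite mul_delta_mx /z !(mulmxDl, mulmxDr) !mul_delta_mx_cond /= => /matrixP/(_ 0 0)/eqP.
by rewrite !mxE /= !addr0 add0r oner_eq0.
Qed.
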